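(* Let $t>s\ge 0$ be integers and let $n$ be a positive integer. Suppose $\mathcal{F}\subset\{0,1\}^n$ is a collection of binary vectors such that for every two distinct $\vec{x},\vec{y}\in\mathcal{F}$, the Hamming distance $d(\vec{x},\vec{y})$ lies in $\{2s+1,2s+2,\dots,2t\}$. Then $$|\mathcal{F}|\le\binom{n}{t-s}+2\sum_{i=0}^{t-s-1}\binom{n}{i}.$$
   Context: The Hamming distance $d(\vec{x},\vec{y})$ between two vectors is the number of coordinates in which they differ. *)

(* Defs.v *)
From mathcomp Require Import all_boot.

Set Implicit Arguments.
Unset Strict Implicit.
Unset Printing Implicit Defensive.

Definition hamming (n : nat) (x y : {ffun 'I_n -> bool}) : nat :=
  #|[set i : 'I_n | x i != y i]|.

(* Main.v *)
Require Import Defs.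
From mathcomp Require Import all_boot.
From mathcomp Require Import all_algebra ring zify.

(** Write m = t - s, P(z) = prod_(s < j <= t) (z - 2j) and
    Q(z) = prod_(s < j <= t) (z - (2j - 1)).  For y in F let f_y(x) be
    2 P(d(x, y)) or 2 Q(d(x, y)) according to the parity of d(x, y).  Then f_y
    vanishes on F except at y, so the f_y are linearly independent.  With e(x)
    the parity sign of x,
      f_y(x) = (P + Q)(d(x, y)) + e(x) e(y) (P - Q)(d(x, y)),
    and d(x, y) is affine in x.  As P and Q are monic of the same degree m, the
    polynomial P - Q has degree less than m, so f_y lies in the sum of the
    multilinear polynomials of degree at most m and of e times those of degree
    at most m - 1. *)

Import GRing.Theory Num.Theory.
Local Open Scope ring_scope.

(** Evaluating a linear relation among the [f y] at a point of [A] kills every term but one, so its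
    coefficient is zero and the family is free. *)
Lemma leq_card_dim_diag (K : fieldType) (T : finType) (A : {set T})
    (U : {vspace {ffun T -> K^o}}) (f : T -> {ffun T -> K^o}) :
  {in A, forall y, f y \in U} ->
  {in A, forall y, f y y != 0} ->
  {in A &, forall x y, x != y -> f y x = 0} ->
  (#|A| <= \dim U)%N.
Proof.
move=> fU f_diag f_off.
pose X := [tuple f (enum_val i) | i < #|A|].
suff freeX : free X.
  rewrite -(size_tuple X) -(eqP freeX); apply/dimvS/span_subvP => v.
  by move=> /codomP[i ->]; apply/fU/enum_valP.
apply/freeP => k k0 i; have iA := enum_valP i.
move/ffunP/(_ (enum_val i)): k0; rewrite sum_ffunE ffunE (bigD1 i) //=.
rewrite big1 => [|j ji]; rewrite ffunE (nth_map i) ?size_enum_ord //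
  nth_ord_enum.
  by rewrite addr0 => /eqP; rewrite mulf_eq0 (negPf (f_diag _ iA)) orbF => /eqP.
rewrite f_off ?enum_valP ?scaler0 //.
by rewrite (inj_eq enum_val_inj) eq_sym.
Qed.

Lemma size_sub_monic (R : nzRingType) (p q : {poly R}) :
  p \is monic -> q \is monic -> size p = size q ->
  (size (p - q)%R <= (size p).-1)%N.
Proof.
move=> /monicP pm /monicP qm pq; apply/leq_sizeP => j.
rewrite leq_eqVlt coefB => /orP[/eqP<-|jp].
  by rewrite {2}pq -!lead_coefE pm qm subrr.
have pj : (size p <= j)%N by lia.
by rewrite !nth_default ?subrr // -pq.
Qed.

Section MultilinearSpaces.

Variables (K : fieldType) (n : nat).
Implicit Types (w : {ffun 'I_n -> bool} -> K) (S : {set 'I_n}).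
Local Notation cube := {ffun 'I_n -> bool}.

(** The weight [w] lets one construction serve both the plain polynomials and those twisted by the
    parity sign. *)
Definition wmonomial w S : {ffun cube -> K^o} :=
  [ffun x => w x * \prod_(i in S) (x i)%:R].

(** The strict bound makes [k] match the size, not the degree, of a univariate polynomial. *)
Definition wpoly w k : {vspace {ffun cube -> K^o}} :=
  (\sum_(S : {set 'I_n} | (#|S| < k)%N) <[wmonomial w S]>)%VS.

Lemma dim_wpoly w k :
  (\dim (wpoly w k) <= \sum_(0 <= i < k) 'C(n, i))%N.
Proof.
apply: leq_trans (dimv_leq_sum _ _ _) _.
apply: (@leq_trans (\sum_(S : {set 'I_n} | (#|S| < k)%N) 1)%N).
  by apply: leq_sum => S _; rewrite dim_vline leq_b1.
rewrite big_mkord; case: k => [|k]; first by rewrite big_pred0.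
rewrite (partition_big (fun S => inord #|S| : 'I_k.+1) xpredT) //=.
apply: leq_sum => i _; rewrite sum1_card -[X in 'C(X, i)]card_ord -card_draws.
apply/subset_leq_card/subsetP => S; rewrite !inE => /andP[Sk /eqP <-].
by rewrite inordK.
Qed.

Lemma wmonomial_in w k S : (#|S| < k)%N -> wmonomial w S \in wpoly w k.
Proof.
by move=> Sk; apply: (subvP (sumv_sup S Sk (subvv _))); apply: memv_line.
Qed.

Lemma wpolyS w k : (wpoly w k <= wpoly w k.+1)%VS.
Proof.
apply/subv_sumP => S Sk; apply/subvP => _ /vlineP[c ->].
by apply/memvZ/wmonomial_in/ltnW.
Qed.

(** Coordinates are 0 or 1, hence idempotent: multiplying by the [i]-th one turns the monomial of
    [S] into that of [i |: S]. *)
Lemma wpoly_mulX w k (i : 'I_n) f :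
  f \in wpoly w k -> [ffun x : cube => (x i)%:R * f x] \in wpoly w k.+1.
Proof.
move=> /memv_sumP[g gS ->].
rewrite (_ : [ffun _ => _] =
    \sum_(S : {set 'I_n} | (#|S| < k)%N) [ffun x : cube => (x i)%:R * g S x]).
  apply: memv_suml => S Sk; have /vlineP[c ->] := gS _ Sk.
  rewrite (_ : [ffun _ => _] = c *: wmonomial w (i |: S)).
    apply/memvZ/wmonomial_in/(@leq_ltn_trans #|S|.+1) => //.
    by rewrite cardsU1; case: (_ \in _).
  apply/ffunP => x; rewrite !ffunE mulrCA; congr (_ * _).
  rewrite mulrCA; congr (_ * _).
  have [iS|iS] := boolP (i \in S); last by rewrite big_setU1.
  rewrite (setUidPr _) ?sub1set // (bigD1 i) //= mulrA.
  by case: (x i); rewrite ?mul1r ?mul0r.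
apply/ffunP => x; rewrite !ffunE !sum_ffunE mulr_sumr.
by apply: eq_bigr => S _; rewrite ffunE.
Qed.

Lemma natr_hamming (x y : cube) :
  (hamming x y)%:R =
  \sum_i ((y i)%:R + (1 - 2 * (y i)%:R) * (x i)%:R) :> K.
Proof.
rewrite /hamming -sum1_card natr_sum big_mkcond /=; apply: eq_bigr => i _.
by rewrite inE; case: (x i); case: (y i) => /=; ring.
Qed.

(** Induction along Horner's scheme: each step multiplies by the distance, which is affine in [x] by
    [natr_hamming], and so costs one degree. *)
Lemma wpoly_horner w k (p : {poly K}) (y : cube) : (size p <= k)%N ->
  [ffun x => w x * p.[(hamming x y)%:R]] \in wpoly w k.
Proof.
have mem_null j (f : {ffun cube -> K^o}) : (forall x, f x = 0) -> f \in wpoly w j.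
  by move=> f0; rewrite (_ : f = 0) ?mem0v //; apply/ffunP => x; rewrite f0 ffunE.
elim/poly_ind: p k => [|p c IH] k.
  by move=> _; apply: mem_null => x; rewrite ffunE horner0 mulr0.
rewrite size_MXaddC; case: ifP => [/andP[/eqP-> /eqP->] _|_].
  by apply: mem_null => x; rewrite ffunE mul0r add0r hornerC mulr0.
case: k => // k /IH{IH}.
set g : {ffun cube -> K^o} := [ffun _ => _] => gk.
rewrite (_ : [ffun _ => _] = \sum_i ((y i)%:R *: g +
   (1 - 2 * (y i)%:R) *: [ffun x : cube => (x i)%:R * g x])
   + c *: wmonomial w set0); last first.
  apply/ffunP => x; rewrite !ffunE sum_ffunE big_set0 mulr1.
  rewrite hornerMXaddC natr_hamming mulrDr mulrA mulr_sumr [w x * c]mulrC.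
  congr (_ + _); apply: eq_bigr => i _.
  by rewrite !ffunE -natr_hamming [LHS]mulrC mulrDl -mulrA.
apply: memvD; last by apply/memvZ/wmonomial_in; rewrite cards0.
apply: memv_suml => i _; apply: memvD; apply: memvZ.
  exact: (subvP (wpolyS w k)).
exact: wpoly_mulX.
Qed.

End MultilinearSpaces.

Section ParitySign.

Variables (R : comNzRingType) (n : nat).

Definition parity_sign (x : {ffun 'I_n -> bool}) : R := \prod_i (-1) ^+ x i.

(** Coordinates where [x] and [y] agree contribute 1 to the product, the others -1. *)
Lemma parity_signM x y :
  parity_sign x * parity_sign y = (-1) ^+ odd (hamming x y).
Proof.
rewrite -big_split /= signr_odd /hamming -sum1_card -prodrXr [RHS]big_mkcond.
apply: eq_bigr => i _; rewrite inE.
by case: (x i); case: (y i); rewrite /= ?expr0 ?expr1 ?mulr1 ?mul1r ?mulrNN ?mulr1.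
Qed.

End ParitySign.

Local Close Scope ring_scope.

Theorem theorem4 (s t n : nat) (F : {set {ffun 'I_n -> bool}})
  (hst : s < t) (hn : 0 < n)
  (hF : forall x y : {ffun 'I_n -> bool}, x \in F -> y \in F -> x != y ->
     2 * s + 1 <= hamming x y <= 2 * t) :
  #|F| <= 'C(n, t - s) + 2 * \sum_(0 <= i < t - s) 'C(n, i).
Proof.
pose J := index_iota s.+1 t.+1.
pose P : {poly rat} := (\prod_(j <- J) ('X - (2 * j)%:R%:P))%R.
pose Q : {poly rat} := (\prod_(j <- J) ('X - (2 * j).-1%:R%:P))%R.
have sJ : size J = t - s by rewrite size_iota subSS.
have sP : size P = (t - s).+1 by rewrite size_prod_XsubC sJ.
have sQ : size Q = (t - s).+1 by rewrite size_prod_XsubC sJ.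
pose e := @parity_sign rat n.
pose g (p : {poly rat}) w y : {ffun {ffun 'I_n -> bool} -> rat^o} :=
  [ffun x => w x * p.[(hamming x y)%:R]]%R.
pose f y := (g (P + Q) (fun=> 1) y + e y *: g (P - Q) e y)%R.
pose U := (wpoly rat n (fun=> 1%R) (t - s).+1 + wpoly rat n e (t - s))%VS.
(* The sign is -1 exactly at odd distance, where (P + Q) - (P - Q) = 2Q; otherwise the sum is 2P. *)
have fE x y : f y x = (2 * (if odd (hamming x y) then Q else P)
                            .[(hamming x y)%:R])%R.
  rewrite !ffunE mul1r hornerD hornerD hornerN.
  rewrite [X in (_ + X)%R]mulrA [(e y * _)%R]mulrC parity_signM.
  by case: odd; rewrite ?expr1 ?expr0; ring.
apply: (@leq_trans (\dim U)); last first.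
  apply: leq_trans (dimv_add_leqif _ _) _.
  apply: leq_trans (leq_add (dim_wpoly _ _ _ _) (dim_wpoly _ _ _ _)) _.
  (* The top binomial occurs only in the untwisted space; all lower ones occur twice. *)
  by rewrite big_nat_recr //=; lia.
apply: (@leq_card_dim_diag _ _ _ _ f) => [y _|y _|x y xF yF xy].
- apply: memv_add; last apply: memvZ; apply: wpoly_horner.
    by rewrite (leq_trans (size_polyD _ _)) // sP sQ maxnn.
  by rewrite -[t - s]/((t - s).+1.-1) -sP size_sub_monic
    ?monic_prod_XsubC // sP sQ.
(* Distance 0 is even, and the roots [2 * j] of [P] are nonzero because j > s. *)
- rewrite fE (_ : hamming y y = 0); last first.
    by apply/eqP; rewrite cards_eq0; apply/eqP/setP => i; rewrite !inE eqxx.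
  rewrite mulf_neq0 //= horner_prod prodf_seq_neq0; apply/allP => j.
  rewrite mem_index_iota => /andP[sj _]; rewrite /= !hornerE oppr_eq0 pnatr_eq0.
  lia.
have /andP[dl du] := hF x y xF yF xy.
rewrite fE; set d := hamming x y in dl du *.
suff /rootP-> : root (if odd d then Q else P) d%:R%R by rewrite mulr0.
(* With j = [uphalf d], the distance is 2j if even and 2j - 1 if odd; the bounds on [d] give s < j
   <= t. *)
have uJ : uphalf d \in J by rewrite mem_index_iota; lia.
case: ifP => d_odd; rewrite /root horner_prod prodf_seq_eq0; apply/hasP;
  exists (uphalf d) => //=; rewrite !hornerE subr_eq0 eqr_nat; lia.
Qed.
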